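(* Let $n \ge 3$. Every finite index subgroup $\Gamma$ of $\mathrm{SL}(n,\mathbb{Z})$ contains a finite index subgroup which is generated by two elements; that is, there exist $a,b \in \Gamma$ such that the subgroup $\langle a,b\rangle$ has finite index in $\Gamma$. *)

(* Defs.v *)
From HB Require Import structures.
From mathcomp Require Import all_boot all_order all_algebra.
From mathcomp Require Import boolp classical_sets functions cardinality.

Set Implicit Arguments.
Unset Strict Implicit.
Unset Printing Implicit Defensive.

Import GRing.Theory.

Section Subgroups.
Local Open Scope classical_set_scope.
Local Open Scope group_scope.
Variable G : groupType.
Implicit Types A H K : set G.

Definition is_subgroup H : Prop := group_closed (mem H).

Definition generated A : set G := smallest is_subgroup A.

(* Left cosets; meant for H and K subgroups, which callers assume or prove. *)
Definition finite_index H K : Prop :=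
  H `<=` K /\ finite_set [set [set g * h | h in H] | g in K].

Lemma is_subgroupP H :
  is_subgroup H <->
  [/\ H 1, forall x y, H x -> H y -> H (x * y) & forall x, H x -> H x^-1].
Proof.
split=> [gH | [H1 HM HV]].
  have [/set_mem H1 _] := gH; split=> // [x y /mem_set Hx /mem_set Hy | x /mem_set Hx].
    exact/set_mem/(group_closedM gH).
  exact/set_mem/(group_closedV gH).
split=> [|x y /set_mem Hx /set_mem Hy]; apply/mem_set => //.
exact/HM/HV.
Qed.

Lemma generated_subgroup A : is_subgroup (generated A).
Proof.
apply/is_subgroupP; split=> [H [/is_subgroupP[]] //|x y Ax Ay H HP|x Ax H HP];
  have [/is_subgroupP[_ HM HV] _] := HP.
  by apply: HM; [apply: Ax|apply: Ay].
by apply: HV; apply: Ax.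
Qed.

End Subgroups.

Section SpecialLinear.
Local Open Scope ring_scope.
Variables (n : nat) (R : comUnitRingType).

(* For arbitrary n the ring of matrices need not be a unit ring, so the group
   law is given through mulmx and invmx rather than as a unit subgroup. *)
Record SL := MkSL { SLval :> 'M[R]_n; _ : \det SLval == 1 }.

HB.instance Definition _ := [isSub for SLval].
HB.instance Definition _ := [Choice of SL by <:].

Implicit Types A B : SL.

Lemma det_SL A : \det A = 1.
Proof. exact/eqP/(valP A). Qed.

Lemma SL_unitmx A : (A : 'M_n) \in unitmx.
Proof. by rewrite unitmxE det_SL unitr1. Qed.

Fact SL_one_proof : \det (1%:M : 'M[R]_n) == 1.
Proof. by rewrite det1. Qed.
Definition SL_one := MkSL SL_one_proof.

Fact SL_mul_proof A B : \det (A *m B) == 1.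
Proof. by rewrite det_mulmx !det_SL mulr1. Qed.
Definition SL_mul A B := MkSL (SL_mul_proof A B).

Fact SL_inv_proof A : \det (invmx A) == 1.
Proof. by rewrite det_inv det_SL invr1. Qed.
Definition SL_inv A := MkSL (SL_inv_proof A).

Fact SL_mulA : associative SL_mul.
Proof. by move=> A B C; apply/val_inj; rewrite /= mulmxA. Qed.
Fact SL_mul1 : left_id SL_one SL_mul.
Proof. by move=> A; apply/val_inj; rewrite /= mul1mx. Qed.
Fact SL_mulr1 : right_id SL_one SL_mul.
Proof. by move=> A; apply/val_inj; rewrite /= mulmx1. Qed.
Fact SL_mulV : left_inverse SL_one SL_inv SL_mul.
Proof. by move=> A; apply/val_inj; rewrite /= mulVmx ?SL_unitmx. Qed.
Fact SL_mulrV : right_inverse SL_one SL_inv SL_mul.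
Proof. by move=> A; apply/val_inj; rewrite /= mulmxV ?SL_unitmx. Qed.

HB.instance Definition _ :=
  isGroup.Build SL SL_mulA SL_mul1 SL_mulr1 SL_mulV SL_mulrV.

End SpecialLinear.

(* Main.v *)
Require Import Defs.
From mathcomp Require Import all_boot all_order all_algebra.
From mathcomp Require Import boolp classical_sets functions cardinality.
From mathcomp Require Import ring.

Set Implicit Arguments.
Unset Strict Implicit.
Unset Printing Implicit Defensive.

Import Order.TTheory GRing.Theory Num.Theory.
Local Open Scope classical_set_scope.

(** Write [e_i] for the standard columns, [f_j] for the standard rows, indexed
    from 0, and [tv v w] for the transvection [1 + v w], where [w v = 0].  Some
    [q > 0] satisfies [g ^ q \in Gamma] for all [g] ([finite_index_exponent]),
    so [Gamma] contains [a = tv (q e_0) f_(n-1)] and the matrix [b] with 1 on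
    the diagonal and [q] just below it ([subdiagonal_mem]).  The claim is that
    [H = <a, b>] has finite index in [SL(n, Z)].

    The transvections in [H].  If [tv (M e_0) f_j] is in [H] and [j > 1], its
    commutator with its own conjugate by [b^-1] is a transvection
    [tv (c e_0) (f_j + q f_(j-1))] with [c <> 0].  Descending from [j = n-1],
    [H] contains a power of every elementary matrix of the first row
    ([first_row_mem]), hence [tv (M e_0) w] for one [M] and all [w] killing
    [e_0], and, conjugating by [b ^ k], [tv (M v) w] for all [v = b ^ k e_0] and
    all [w] killing [v] ([orbit_mem]).  The vectors [b ^ k e_0], [k < n], are the
    columns of a triangular matrix [P] with nonzero determinant; conjugation by
    [P] carries what has been found to powers of all elementary matrices.  From
    these one reaches every vector: a row killing a unimodular [v] is a
    combination of the Koszul rows [v_l f_k - v_k f_l], and, since [n >= 3], the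
    transvections along Koszul rows are products of elementary matrices and of
    commutators of such, taken through a third index ([tv_unimodular_mem]).  So,
    for a single [m > 0], [H] contains [tv (m v) w] for all unimodular [v] and
    all [w] killing [v] ([two_generators_transvections]).

    Finite index.  Let [T] be the normal subgroup generated by the transvections
    [tv (m v) w] just named.  The same manipulation of Koszul rows shows that a
    matrix congruent to 1 modulo [m] commutes modulo [T] with all elementary
    matrices ([congruence_central]).  So an elementary matrix has, modulo [T],
    only finitely many conjugates; its [m]-th power lies in [T]; and elementary
    matrices generate [SL(n, Z)] ([elementary_generate]).  A group generated by a
    finite conjugation-stable set of elements of finite order is finite
    ([dietzmann]), so [T], and with it [H], has finite index
    ([transvections_cover]). *)

(** * Subgroups of finite index *)

Section Subgroup.
Local Open Scope group_scope.
Variable G : groupType.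
Implicit Types (A H K T : set G).

Lemma subgroup1 H : is_subgroup H -> H 1.
Proof. by case/is_subgroupP. Qed.

Lemma subgroupM H x y : is_subgroup H -> H x -> H y -> H (x * y).
Proof. by case/is_subgroupP=> _ HM _; apply: HM. Qed.

Lemma subgroupV H x : is_subgroup H -> H x -> H x^-1.
Proof. by case/is_subgroupP=> _ _; apply. Qed.

Lemma subgroupX H x k : is_subgroup H -> H x -> H (x ^+ k).
Proof.
move=> gH Hx; elim: k => [|k IH]; first exact: subgroup1.
by rewrite expgS; apply: subgroupM.
Qed.

Lemma subgroup_commutator H x y :
  is_subgroup H -> H x -> H y -> H (x * y * x^-1 * y^-1).
Proof.
by move=> gH Hx Hy; do !apply: subgroupM => //; apply: subgroupV.
Qed.

Lemma sub_generated A : A `<=` generated A.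
Proof. by move=> x Ax H [_]; apply. Qed.

Lemma generated_sub A H : is_subgroup H -> A `<=` H -> generated A `<=` H.
Proof. by move=> gH AH x; apply. Qed.

Definition normal_subgroup T :=
  is_subgroup T /\ forall g t, T t -> T (g * t * g^-1).

Lemma generated_normal A :
  (forall g x, A x -> A (g * x * g^-1)) -> normal_subgroup (generated A).
Proof.
move=> AJ; split=> [|g t]; first exact: generated_subgroup.
pose K : set G := [set x | generated A (g * x * g^-1)].
have gA := generated_subgroup A.
suff sub : generated A `<=` K by exact: sub.
apply: generated_sub => [|x Ax]; last by apply: (sub_generated (AJ g x Ax)).
apply/is_subgroupP; split; rewrite /K /=.
- by rewrite mulg1 mulgV; apply: (subgroup1 gA).
- move=> x y Hx Hy.
  have -> : g * (x * y) * g^-1 = (g * x * g^-1) * (g * y * g^-1).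
    by rewrite !mulgA mulgVK.
  exact: (subgroupM gA).
- move=> x Hx.
  have -> : g * x^-1 * g^-1 = (g * x * g^-1)^-1 by rewrite !invgM invgK mulgA.
  exact: (subgroupV gA).
Qed.

(** By the pigeonhole principle, two of the first [r + 1] powers of [g] share a
    coset, where [r] is the index; hence [g ^ i] is in [H] for some
    [0 < i <= r], and [i] divides [r!]. *)
Lemma finite_index_exponent H : is_subgroup H -> finite_index H setT ->
  exists2 q, (0 < q)%N & forall g, H (g ^+ q).
Proof.
move=> gH [_ /finite_seqP[s Es]].
exists ((size s)`!)%N => [|g]; first exact: fact_gt0.
pose coset (k : nat) : set G := [set g ^+ k * h | h in H].
have coset_s k : coset k \in s.
  have : [set` s] (coset k) by rewrite -Es; exists (g ^+ k).
  by [].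
have : ~~ uniq (map coset (iota 0 (size s).+1)).
  apply/negP=> u.
  have sub : {subset map coset (iota 0 (size s).+1) <= s} by move=> c /mapP[k _ ->].
  by have := uniq_leq_size u sub; rewrite size_map size_iota ltnn.
case/(uniqPn set0) => i [j [ltij]]; rewrite size_map size_iota => ltj.
rewrite !(nth_map 0%N) ?size_iota ?(ltn_trans ltij ltj) //.
rewrite !nth_iota ?(ltn_trans ltij ltj) // !add0n => Eij.
have : coset j (g ^+ j) by exists 1; [apply: subgroup1 | rewrite mulg1].
rewrite -Eij => -[h Hh Eh].
have Hji : H (g ^+ (j - i)).
  by move: Eh; rewrite -{1}(subnKC (ltnW ltij)) expgnDr => /mulgI <-.
have ji_le : ((j - i) %| (size s)`!)%N.
  by rewrite dvdn_fact // subn_gt0 ltij /= (leq_trans (leq_subr _ _)).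
by rewrite -(divnK ji_le) mulnC expgnA; apply: subgroupX.
Qed.

(** Finite index is used below in the form of a finite list of elements meeting
    every left coset of [T], for a subgroup [T] of [H]. *)
Lemma finite_index_of_cover (S : seq G) T H K :
  is_subgroup H -> T `<=` H -> H `<=` K ->
  (forall g, exists2 s, s \in S & T (s^-1 * g)) -> finite_index H K.
Proof.
move=> gH TH HK cover; split=> //.
apply: (@sub_finite_set _ _ ((fun g => [set g * h | h in H]) @` [set` S])).
  move=> _ [g Kg <-]; have [s sS Tsg] := cover g; exists s => //.
  rewrite eqEsubset; split=> _ [h Hh <-].
    exists ((s^-1 * g)^-1 * h); last by rewrite invgM invgK !mulgA mulgV mul1g.
    by apply: (subgroupM gH) => //; apply: (subgroupV gH); apply: TH.
  exists (s^-1 * g * h); last by rewrite !mulgA mulgV mul1g.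
  by apply: subgroupM => //; apply: TH.
exact/finite_image/finite_seq.
Qed.

End Subgroup.

(** * Groups generated by finitely many torsion conjugates *)

Section Dietzmann.
Local Open Scope group_scope.
Variables (G : groupType) (T : set G).
Hypothesis nT : normal_subgroup T.
Implicit Types (x y z g : G) (s X : seq G).

(** Equality in the quotient of [G] by [T]; normality of [T] makes it a
    congruence. *)
Definition eqmod x y := T (x^-1 * y).

Lemma eqmod_refl x : eqmod x x.
Proof. by rewrite /eqmod mulVg; case: nT => gT _; apply: subgroup1. Qed.

Lemma eqmod_sym x y : eqmod x y -> eqmod y x.
Proof.
case: nT => gT _; rewrite /eqmod => /(subgroupV gT).
by rewrite invgM invgK.
Qed.

Lemma eqmod_trans y x z : eqmod x y -> eqmod y z -> eqmod x z.
Proof.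
case: nT => gT _; rewrite /eqmod => xy /(subgroupM gT xy).
by rewrite mulgA mulgK.
Qed.

Lemma eqmodM x x' y y' : eqmod x x' -> eqmod y y' -> eqmod (x * y) (x' * y').
Proof.
case: nT => gT nTJ; rewrite /eqmod => xx' yy'.
have -> : (x * y)^-1 * (x' * y') = (y^-1 * (x^-1 * x') * y^-1^-1) * (y^-1 * y').
  by rewrite invgM invgK !mulgA mulgK.
by apply: subgroupM => //; apply: nTJ.
Qed.

Lemma eqmodV x y : eqmod x y -> eqmod x^-1 y^-1.
Proof.
case: nT => gT nTJ; rewrite /eqmod invgK => /(subgroupV gT)/(nTJ x).
by rewrite invgM invgK mulgA mulgK.
Qed.

Lemma eqmod1 t : T t -> eqmod t 1.
Proof. by case: nT => gT _; rewrite /eqmod mulg1; apply: subgroupV. Qed.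

Definition word s := foldr *%g 1 s.

Lemma word_cat s1 s2 : word (s1 ++ s2) = word s1 * word s2.
Proof. by elim: s1 => [|x s IH] /=; rewrite ?mul1g // IH mulgA. Qed.

Fixpoint words X k :=
  if k is k'.+1 then 1 :: [seq x * w | x <- X, w <- words X k'] else [:: 1].

Lemma word_words X k s :
  {subset s <= X} -> (size s <= k)%N -> word s \in words X k.
Proof.
elim: k s => [|k IH] [|x s] //= sX lesk; rewrite inE ?eqxx //.
apply/orP; right; apply/allpairsP; exists (x, word s); split=> //=.
  by apply: sX; rewrite mem_head.
by apply: IH => // y ys; apply: sX; rewrite in_cons ys orbT.
Qed.

Variables (X : seq G) (e : nat).
Hypothesis e_gt0 : (0 < e)%N.
Hypothesis XJ : forall g x, x \in X ->
  exists2 x', x' \in X & eqmod (g * x * g^-1) x'.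
Hypothesis Xe : forall x, x \in X -> T (x ^+ e).

(** The occurrences of [x] can be moved to the front of a word: each letter they
    jump over is conjugated, so stays in [X] modulo [T], and the length of the
    word does not change. *)
Lemma pull_power x k s : {subset s <= X} -> (k <= count_mem x s)%N ->
  exists s', [/\ {subset s' <= X}, size s = (k + size s')%N &
    eqmod (word s) (x ^+ k * word s')].
Proof.
elim: s k => [|y s IH] k /= sX.
  rewrite leqn0 => /eqP->; exists [::]; split=> //.
  by rewrite expg0 mul1g; apply: eqmod_refl.
have yX : y \in X by apply: sX; rewrite mem_head.
have {}sX : {subset s <= X} by move=> z zs; apply: sX; rewrite in_cons zs orbT.
have [yx|neq] := eqVneq y x; last first.
  rewrite add0n => /(IH _ sX)[s' [s'X Es eqs]].
  have [y' y'X eqy] := XJ (x ^+ k)^-1 yX.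
  exists (y' :: s'); split=> [z||] /=.
  - by rewrite in_cons => /predU1P[->|/s'X].
  - by rewrite Es addnS.
  apply: (eqmod_trans (eqmodM (eqmod_refl y) eqs)).
  have -> : y * (x ^+ k * word s') =
            x ^+ k * (((x ^+ k)^-1 * y * (x ^+ k)^-1^-1) * word s').
    by rewrite invgK !mulgA mulgV mul1g.
  apply: eqmodM; first exact: eqmod_refl.
  by apply: eqmodM => //; apply: eqmod_refl.
subst y; case: k => [_|k].
  exists (x :: s); split=> [z||] //=; last by rewrite expg0 mul1g; apply: eqmod_refl.
  by rewrite in_cons => /predU1P[->|/sX].
rewrite add1n ltnS => /(IH _ sX)[s' [s'X Es eqs]].
exists s'; split=> //; first by rewrite Es.
by rewrite expgS -mulgA; apply: eqmodM => //; apply: eqmod_refl.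
Qed.

Lemma size_le_count (Y s : seq G) : {subset s <= Y} ->
  (forall x, (count_mem x s <= e)%N) -> (size s <= size Y * e)%N.
Proof.
elim: Y s => [|x Y IH] s sY les; first by case: s sY {les} => // x s /(_ x (mem_head _ _)).
rewrite -(count_predC (pred1 x)) mulSn leq_add // -size_filter IH //.
  by move=> y; rewrite mem_filter /= => /andP[yx /sY]; rewrite in_cons (negPf yx).
by move=> y; apply: leq_trans (les y); apply: leq_count_subseq; apply: filter_subseq.
Qed.

(** In a word of more than [size X * e] letters some [x] occurs at least [e]
    times; once moved to the front, [x ^ e] vanishes modulo [T]. *)
Lemma shorten s : {subset s <= X} -> (size X * e < size s)%N ->
  exists s', [/\ {subset s' <= X}, (size s' < size s)%N &
    eqmod (word s) (word s')].
Proof.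
move=> sX lt_s.
have [x le_e] : exists x, (e <= count_mem x s)%N.
  apply: contrapT => /forallNP nX; move: lt_s; rewrite ltnNge.
  by rewrite size_le_count // => x; rewrite ltnW // ltnNge; apply/negP.
have xX : x \in X by apply: sX; rewrite -has_pred1 has_count (leq_trans e_gt0).
have [s' [s'X Es eqs]] := pull_power sX le_e.
exists s'; split=> //; first by rewrite Es -[ltnLHS]add0n ltn_add2r.
apply: (eqmod_trans eqs); rewrite -[X in eqmod _ X]mul1g.
by apply: eqmodM; [apply/eqmod1/Xe | apply: eqmod_refl].
Qed.

Lemma short_word s : {subset s <= X} ->
  exists2 w, w \in words X (size X * e) & eqmod (word s) w.
Proof.
have [k] := ubnP (size s); elim: k s => // k IH s; rewrite ltnS => les sX.
have [le_s|/(shorten sX)[s' [s'X lts' eqs]]] := leqP (size s) (size X * e).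
  by exists (word s); [apply: word_words | apply: eqmod_refl].
have [w wX eqw] := IH s' (leq_trans lts' les) s'X.
by exists w => //; apply: eqmod_trans eqw.
Qed.

Lemma word_nseq k x : word (nseq k x) = x ^+ k.
Proof. by elim: k => //= k ->; rewrite expgS. Qed.

Lemma word_inv s : {subset s <= X} ->
  exists2 s', {subset s' <= X} & eqmod (word s') (word s)^-1.
Proof.
elim: s => [_|x s IH sX] /=; first by exists [::] => //=; rewrite invg1; apply: eqmod_refl.
have xX : x \in X by apply: sX; rewrite mem_head.
have [s' s'X eqs'] : exists2 s', {subset s' <= X} & eqmod (word s') (word s)^-1.
  by apply: IH => z zs; apply: sX; rewrite in_cons zs orbT.
exists (s' ++ nseq e.-1 x) => [z|].
  by rewrite mem_cat mem_nseq => /orP[/s'X|/andP[_ /eqP->]].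
rewrite word_cat word_nseq invgM; apply: eqmodM => //.
by apply: eqmod_sym; rewrite /eqmod invgK -expgS prednK //; apply: Xe.
Qed.

Lemma word_subgroup :
  is_subgroup [set g | exists2 s, {subset s <= X} & eqmod (word s) g].
Proof.
apply/is_subgroupP; split=> /=.
- by exists [::] => //; apply: eqmod_refl.
- move=> g h [s sX eqs] [s' s'X eqs']; exists (s ++ s') => [z|].
    by rewrite mem_cat => /orP[/sX|/s'X].
  by rewrite word_cat; apply: eqmodM.
- move=> g [s sX eqs]; have [s' s'X eqs'] := word_inv sX.
  by exists s' => //; apply: eqmod_trans eqs' (eqmodV eqs).
Qed.

(** Dietzmann's lemma for the quotient by [T]: the words in [X] form a subgroup
    modulo [T], because [x ^ (e - 1)] inverts [x], and each of them can be
    shortened to a length of at most [size X * e]. *)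
Theorem dietzmann :
  (forall H, is_subgroup H -> T `<=` H -> {in X, forall x, H x} -> forall g, H g) ->
  exists S : seq G, forall g, exists2 s, s \in S & T (s^-1 * g).
Proof.
move=> gen; exists (words X (size X * e)) => g.
have [t Tt|x xX|s sX eqs] := gen _ word_subgroup _ _ g.
- by exists [::] => //=; apply/eqmod_sym/eqmod1.
- exists [:: x] => [z|] /=; first by rewrite inE => /eqP->.
  by rewrite mulg1; apply: eqmod_refl.
have [w wX eqw] := short_word sX.
by exists w => //; apply: eqmod_trans eqs; apply: eqmod_sym.
Qed.

End Dietzmann.

(** * Transvections *)

Section Transvection.
Local Open Scope ring_scope.
Variable n : nat.
Implicit Types (v : 'cV[int]_n) (w : 'rV[int]_n) (g : SL n int) (K : set (SL n int)).

Definition ecol (i : 'I_n) : 'cV[int]_n := delta_mx i 0.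
Definition erow (j : 'I_n) : 'rV[int]_n := delta_mx 0 j.

Lemma erow_mul j v : erow j *m v = (v j 0)%:M.
Proof. by rewrite -rowE; apply/matrixP=> a b; rewrite !ord1 !mxE. Qed.

Lemma mul_ecol w i : w *m ecol i = (w 0 i)%:M.
Proof. by rewrite -colE; apply/matrixP=> a b; rewrite !ord1 !mxE. Qed.

Lemma erow_ecol i j : erow j *m ecol i = (i == j)%:R%:M.
Proof. by rewrite erow_mul mxE eqxx andbT eq_sym. Qed.

Lemma row_sum_erow w : w = \sum_j w 0 j *: erow j.
Proof. exact: row_sum_delta. Qed.

Lemma col_sum_ecol v : v = \sum_i v i 0 *: ecol i.
Proof.
apply/colP=> i; rewrite summxE (bigD1 i) //= big1 => [|j ji].
  by rewrite !mxE !eqxx mulr1 addr0.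
by rewrite !mxE eq_sym (negPf ji) mulr0.
Qed.

(** Both sides are the determinant of the block matrix with rows [1, - w] and
    [v, 1], reduced by either of its two diagonal blocks. *)
Lemma det_1D_mul v w : \det (1%:M + v *m w) = 1 + (w *m v) 0 0.
Proof.
have E : block_mx 1%:M (- w) v 1%:M =
    block_mx 1%:M 0 v 1%:M *m block_mx 1%:M (- w) 0 (1%:M + v *m w).
  rewrite mulmx_block !mulmx1 !mul1mx ?(mul0mx, mulmx0, addr0).
  by rewrite mulmxN addrCA addNr addr0.
have E' : block_mx 1%:M (- w) v 1%:M =
    block_mx 1%:M (- w) 0 1%:M *m block_mx (1%:M + w *m v) 0 v 1%:M.
  rewrite mulmx_block !mulmx1 !mul1mx ?(mul0mx, mulmx0, add0r).
  by rewrite mulNmx addrK.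
have := congr1 determinant E'; rewrite E !det_mulmx !det_lblock !det_ublock.
by rewrite !det1 !mul1r !mulr1 => ->; rewrite det_mx11 !mxE.
Qed.

(** The transvection [1 + v w]; the value is the identity matrix whenever
    [1 + v w] has determinant different from 1, that is when [w v <> 0]. *)
Definition tv v w : SL n int := insubd (1%g : SL n int) (1%:M + v *m w).

Lemma val_tv v w : w *m v = 0 -> tv v w = 1%:M + v *m w :> 'M_n.
Proof. by move=> wv; rewrite /tv val_insubd det_1D_mul wv mxE addr0 eqxx. Qed.

Lemma tv_addr v w w' : w *m v = 0 -> w' *m v = 0 ->
  (tv v w * tv v w')%g = tv v (w + w').
Proof.
move=> wv w'v; apply/val_inj => /=.
rewrite !val_tv ?mulmxDl ?wv ?w'v ?addr0 // !mulmxDr !mulmx1 mul1mx.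
by rewrite !mulmxA -[_ *m w *m v]mulmxA wv mulmx0 mul0mx addr0 -addrA; congr (_ + _); rewrite addrC.
Qed.

Lemma tv_addl v v' w : w *m v = 0 -> w *m v' = 0 ->
  (tv v w * tv v' w)%g = tv (v + v') w.
Proof.
move=> wv wv'; apply/val_inj => /=.
rewrite !val_tv ?mulmxDr ?wv ?wv' ?addr0 // !mulmxDl !mulmx1 mul1mx.
by rewrite !mulmxA -[_ *m w *m v']mulmxA wv' mulmx0 mul0mx addr0 -addrA; congr (_ + _); rewrite addrC.
Qed.

Lemma tv0r v : tv v 0 = 1%g.
Proof. by apply/val_inj; rewrite /= val_tv ?mul0mx // mulmx0 addr0. Qed.

Lemma tv0l w : tv 0 w = 1%g.
Proof. by apply/val_inj; rewrite /= val_tv ?mulmx0 // mul0mx addr0. Qed.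

Lemma tv_scale c v w : tv (c *: v) w = tv v (c *: w).
Proof. by rewrite /tv -scalemxAl scalemxAr. Qed.

Lemma tv_inv v w : w *m v = 0 -> ((tv v w)^-1)%g = tv v (- w).
Proof. by move=> wv; apply: mulg1_eq; rewrite tv_addr ?mulNmx ?wv ?oppr0 // addrN tv0r. Qed.

Lemma tv_exp v w k : w *m v = 0 -> (tv v w ^+ k)%g = tv v (k%:R *: w).
Proof.
move=> wv; elim: k => [|k IH]; first by rewrite scale0r tv0r.
by rewrite expgS IH tv_addr -?scalemxAl ?wv ?scaler0 // mulrS scalerDl scale1r.
Qed.

Lemma tv_conj g v w : w *m v = 0 ->
  (g * tv v w * g^-1)%g = tv (g *m v) (w *m invmx g).
Proof.
move=> wv; apply/val_inj => /=; have ug := SL_unitmx g.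
rewrite !val_tv //; last by rewrite mulmxA mulmxKV.
by rewrite mulmxDr mulmxDl mulmx1 mulmxV // !mulmxA.
Qed.

(** The Heisenberg relation: with [w' v = 0] the two transvections commute up to
    a third one, scaled by the number [w v']. *)
Lemma tv_commutator v v' w w' :
  w *m v = 0 -> w' *m v' = 0 -> w' *m v = 0 ->
  (tv v w * tv v' w' * (tv v w)^-1 * (tv v' w')^-1)%g = tv v (w *m v' *m w').
Proof.
move=> wv w'v' w'v.
have iv : invmx (tv v w) = 1%:M - v *m w.
  by rewrite -[invmx _]/(SLval (tv v w)^-1%g) tv_inv // val_tv ?mulmxN // mulNmx wv oppr0.
rewrite tv_conj // iv val_tv // tv_inv // -[- w']scaleN1r -tv_scale scaleN1r.
rewrite mulmxDl mul1mx mulmxBr mulmx1 !mulmxA w'v mul0mx subr0.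
rewrite tv_addl ?mulmxN ?w'v' ?oppr0 //; last first.
  by rewrite mulmxDr w'v' !mulmxA w'v !mul0mx addr0.
by rewrite addrAC addrN add0r /tv -!mulmxA.
Qed.

Lemma tv_sumr K v (I : finType) (F : I -> 'rV_n) : is_subgroup K ->
  (forall i, F i *m v = 0) -> (forall i, K (tv v (F i))) ->
  K (tv v (\sum_i F i)).
Proof.
move=> gK Fv KF; suff [] : (\sum_i F i) *m v = 0 /\ K (tv v (\sum_i F i)) by [].
elim/big_ind: _ => [|x y [xv Kx] [yv Ky]|i _]; last by [].
  by rewrite mul0mx tv0r; split=> //; apply: subgroup1.
by rewrite mulmxDl xv yv addr0 -tv_addr //; split=> //; apply: subgroupM.
Qed.

Lemma tv_suml K w (I : finType) (F : I -> 'cV_n) : is_subgroup K ->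
  (forall i, w *m F i = 0) -> (forall i, K (tv (F i) w)) ->
  K (tv (\sum_i F i) w).
Proof.
move=> gK Fw KF; suff [] : w *m (\sum_i F i) = 0 /\ K (tv (\sum_i F i) w) by [].
elim/big_ind: _ => [|x y [xv Kx] [yv Ky]|i _]; last by [].
  by rewrite mulmx0 tv0l; split=> //; apply: subgroup1.
by rewrite mulmxDr xv yv addr0 -tv_addl //; split=> //; apply: subgroupM.
Qed.

Lemma tv_intr K v w (c : int) : is_subgroup K -> w *m v = 0 ->
  K (tv v w) -> K (tv v (c *: w)).
Proof.
move=> gK wv Kvw; have [|k|k] := intP c.
- by rewrite scale0r tv0r; apply: subgroup1.
- rewrite -[_%:Z]natz -tv_exp //; exact: subgroupX.
- rewrite scaleNr -tv_inv -?scalemxAl ?wv ?scaler0 //.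
  by rewrite -[_%:Z]natz -tv_exp //; apply: subgroupV => //; apply: subgroupX.
Qed.

(** When [v] and [w] have disjoint supports, [1 + c v w] is the product of the
    commuting elementary matrices [1 + c v_i w_j E_ij]. *)
Lemma tv_disjoint K (c : int) v w : is_subgroup K ->
  (forall i, v i 0 = 0 \/ w 0 i = 0) ->
  (forall i j, i != j -> v i 0 != 0 -> w 0 j != 0 -> K (tv (c *: ecol i) (erow j))) ->
  K (tv (c *: v) w).
Proof.
move=> gK disj KE.
have wE i : v i 0 != 0 -> w *m ecol i = 0.
  by move=> vi; rewrite mul_ecol; case: (disj i) => [/eqP|->]; rewrite ?(negPf vi) ?raddf0.
have Kc i : v i 0 != 0 -> K (tv (c *: ecol i) w).
  move=> vi; rewrite (row_sum_erow w); apply: tv_sumr => // j.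
    have [->|wj] := eqVneq (w 0 j) 0; first by rewrite scale0r mul0mx.
    have ij : i != j by apply: contraNneq wj => <-; case: (disj i) => [v0|-> //]; move: vi; rewrite v0 eqxx.
    by rewrite -scalemxAl -scalemxAr erow_ecol (negPf ij) raddf0 !scaler0.
  have [->|wj] := eqVneq (w 0 j) 0; first by rewrite scale0r tv0r; apply: subgroup1.
  have ij : i != j by apply: contraNneq wj => <-; case: (disj i) => [v0|-> //]; move: vi; rewrite v0 eqxx.
  apply: tv_intr => //; last exact: KE.
  by rewrite -scalemxAr erow_ecol (negPf ij) raddf0 scaler0.
rewrite (col_sum_ecol v) scaler_sumr; apply: tv_suml => // i;
  have [->|vi] := eqVneq (v i 0) 0; rewrite ?scale0r ?scaler0.
- by rewrite mulmx0.
- by rewrite -!scalemxAr wE // !scaler0.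
- by rewrite tv0l; apply: subgroup1.
rewrite scalerA mulrC -scalerA tv_scale; apply: tv_intr => //; last exact: Kc.
by rewrite -scalemxAr wE // scaler0.
Qed.

End Transvection.

(** * Elementary matrices generate the special linear group over the integers *)

Section Gauss.
Local Open Scope ring_scope.
Variable n : nat.
Implicit Types (v : 'cV[int]_n) (w u : 'rV[int]_n) (g : SL n int).
Variable K : set (SL n int).
Hypothesis gK : is_subgroup K.
Hypothesis KE : forall i j : 'I_n, i != j -> K (tv (ecol i) (erow j)).

Lemma elementary_int (c : int) (i j : 'I_n) : i != j ->
  K (tv (c *: ecol i) (erow j)).
Proof.
move=> ij; rewrite tv_scale; apply: tv_intr => //; last exact: KE.
by rewrite erow_ecol (negPf ij) raddf0.
Qed.

Definition unit_columns (t : nat) g := forall a b : 'I_n, (b < t)%N -> g a b = (a == b)%:R.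

Lemma tv_erow_mul v (j : 'I_n) g a b : v j 0 = 0 ->
  (tv v (erow j) * g)%g a b = g a b + v a 0 * g j b.
Proof.
move=> vj; rewrite [SLval _]/= val_tv ?erow_mul ?vj ?raddf0 //.
rewrite mulmxDl mul1mx -mulmxA -rowE mxE; congr (_ + _).
by rewrite mxE big_ord1 !mxE.
Qed.

Lemma unit_columns_tv_erow t v (j : 'I_n) g : v j 0 = 0 -> (t <= j)%N ->
  unit_columns t g -> unit_columns t (tv v (erow j) * g)%g.
Proof.
move=> vj tj sg a b bt; rewrite tv_erow_mul // !sg //.
have /negPf-> : j != b by apply: contraTneq tj => ->; rewrite -ltnNge.
by rewrite mulr0 addr0.
Qed.

Lemma rowop_mul (c : int) (i j : 'I_n) g a b : i != j ->
  (tv (c *: ecol i) (erow j) * g)%g a b = g a b + c * (a == i)%:R * g j b.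
Proof.
by move=> ij; rewrite tv_erow_mul !mxE ?andbT // eq_sym (negPf ij) mulr0.
Qed.

Lemma unit_columns_rowop t (c : int) (i j : 'I_n) g : i != j -> (t <= j)%N ->
  unit_columns t g -> unit_columns t (tv (c *: ecol i) (erow j) * g)%g.
Proof.
by move=> ij; apply: unit_columns_tv_erow; rewrite !mxE andbT eq_sym (negPf ij) mulr0.
Qed.

Lemma mulK_mem x g : K x -> K (x * g)%g -> K g.
Proof.
move=> Kx Kxg; rewrite -[g](mulKg x); apply: subgroupM => //; exact: subgroupV.
Qed.

Lemma rowop_mem (c : int) (i j : 'I_n) g : i != j ->
  K (tv (c *: ecol i) (erow j) * g)%g -> K g.
Proof. by move=> ij; apply: mulK_mem; apply: elementary_int. Qed.

(** One step of Gauss elimination: columns before [t] are already standard, and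
    it suffices to make column [t] standard too. *)
Section Column.
Variable t : 'I_n.
Hypothesis Kt : forall g, unit_columns t.+1 g -> K g.

Lemma column_clear g : unit_columns t g -> g t t = 1 -> K g.
Proof.
move=> sg gtt; pose v : 'cV[int]_n := \col_i ((i == t)%:R - g i t).
have vt : v t 0 = 0 by rewrite mxE eqxx gtt subrr.
apply: (@mulK_mem (tv v (erow t))).
  rewrite -[v]scale1r; apply: tv_disjoint => // [i|i j ij _ _].
    have [->|it] := eqVneq i t; first by left.
    by right; rewrite mxE (negPf it) andbF.
  by rewrite scale1r; apply: KE.
apply: Kt => a b; rewrite ltnS leq_eqVlt => /predU1P[/val_inj->|bt]; last first.
  exact: (unit_columns_tv_erow vt (leqnn t) sg).
by rewrite tv_erow_mul // gtt mulr1 mxE addrC subrK.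
Qed.

Lemma column_unit_off g (p : 'I_n) : unit_columns t g -> (t < p)%N -> g p t * g p t = 1 -> K g.
Proof.
move=> sg tp gp; have tp' : t != p by rewrite -val_eqE /= ltn_eqF.
apply: (@rowop_mem (g p t * (1 - g t t)) t p) => //.
apply: column_clear; first by apply: unit_columns_rowop => //; apply: ltnW.
by rewrite rowop_mul // eqxx mulr1 mulrAC gp mul1r addrC subrK.
Qed.

Lemma det_last_column g : unit_columns t g -> t.+1 = n -> g t t = 1.
Proof.
move=> sg tn; have := det_SL g; rewrite -det_tr det_trig.
  rewrite (bigD1 t) //= big1 ?mulr1 ?mxE // => i it; rewrite mxE sg ?eqxx //.
  by move: (ltn_ord i) it; rewrite -val_eqE -[in ltnRHS]tn ltnS leq_eqVlt /= => /orP[->|].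
apply/is_trig_mxP => i j ij; rewrite mxE sg; first by rewrite -val_eqE /= gtn_eqF.
by rewrite (leq_trans ij) // -ltnS tn.
Qed.

(** A diagonal entry [-1] is repaired by first creating a 1 in the next row; in
    the last column there is no next row, but there the determinant forces the
    entry to be 1. *)
Lemma column_unit g (p : 'I_n) : unit_columns t g -> (t <= p)%N -> g p t * g p t = 1 -> K g.
Proof.
move=> sg; rewrite leq_eqVlt => /predU1P[/val_inj<-|]; last exact: column_unit_off.
move=> gtt; have := ltn_ord t; rewrite leq_eqVlt => /predU1P[tn|tn].
  by apply: column_clear => //; apply: det_last_column.
pose p' := Ordinal tn; have pt : p' != t by rewrite -val_eqE /= gtn_eqF.
apply: (@rowop_mem (g t t * (1 - g p' t)) p' t) => //.
apply: (@column_unit_off _ p') => //; first exact: unit_columns_rowop.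
by rewrite rowop_mul // eqxx mulr1 mulrAC gtt mul1r addrC subrK mulr1.
Qed.

Lemma unit_columns_inv_row g : unit_columns t g -> exists u : 'rV[int]_n,
  \sum_(a : 'I_n | (t <= a)%N) u 0 a * g a t = 1.
Proof.
move=> sg; pose u := row t (invmx g); exists u.
have ug b : (u *m g) 0 b = (t == b)%:R.
  by rewrite -row_mul mulVmx ?SL_unitmx // !mxE.
have u0 (a : 'I_n) : (a < t)%N -> u 0 a = 0.
  move=> at_; have := ug a; rewrite -val_eqE /= gtn_eqF // mxE (bigD1 a) //= sg // eqxx mulr1.
  by rewrite big1 ?addr0 // => i ia; rewrite sg // (negPf ia) mulr0.
have := ug t; rewrite eqxx mxE (bigID (fun a : 'I_n => (t <= a)%N)) /=.
by rewrite [X in _ + X]big1 ?addr0 // => a; rewrite -ltnNge => /u0->; rewrite mul0r.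
Qed.

Definition colsize g := (\sum_(i : 'I_n | (t <= i)%N) `|g i t|)%N.

(** The Euclidean algorithm on the entries of column [t] in rows [t, t + 1, ...]:
    a nonzero entry of least absolute value reduces any other nonzero entry, and
    if there is no other one it must be a unit, as these entries are coprime by
    [unit_columns_inv_row]. *)
Lemma column_reduce g : unit_columns t g -> K g.
Proof.
have [k] := ubnP (colsize g); elim: k g => // k IH g; rewrite ltnS => le_k sg.
have [u uE] := unit_columns_inv_row sg.
have [p0 /andP[tp0 gp0]] : exists p : 'I_n, (t <= p)%N && (g p t != 0).
  apply/existsP; apply: contraPT uE => /existsPn g0.
  rewrite big1 // => a ta; have := g0 a; rewrite ta negbK => /eqP->.
  by rewrite mulr0.
have [p /andP[tp gp] min_p] :=
  @arg_minnP _ p0 [pred p : 'I_n | (t <= p)%N && (g p t != 0)] (fun p => `|g p t|%N)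
    (introT andP (conj tp0 gp0)).
have [/existsP[i /and3P[ti ip gi]]|/existsPn only_p] :=
    boolP [exists i : 'I_n, [&& (t <= i)%N, i != p & g i t != 0]]; last first.
  apply: (column_unit sg tp); move: uE; rewrite (bigD1 p) //= big1 ?addr0; last first.
    move=> i /andP[ti ip]; have := only_p i; rewrite ti ip negbK => /eqP->.
    by rewrite mulr0.
  move=> up; have : g p t \is a intUnitRing.unitz := intUnitRing.unitzPl up.
  by case/orP=> /eqP->.
apply: (@rowop_mem (- (g i t %/ g p t)%Z) i p) => //.
apply: IH; last exact: unit_columns_rowop.
apply: leq_trans le_k; rewrite /colsize [ltnLHS](bigD1 i) //= [ltnRHS](bigD1 i) //=.
rewrite -addSn leq_add //; last first.
  apply: leq_sum => a /andP[_ ai].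
  by rewrite rowop_mul // (negPf ai) mulr0 mul0r addr0.
rewrite rowop_mul // eqxx mulr1 mulNr.
have le_pi := min_p i (introT andP (conj ti gi)).
apply: leq_trans le_pi.
by rewrite {1}(divz_eq (g i t) (g p t)) addrAC subrr add0r -ltz_nat
  gez0_abs ?modz_ge0 // ltz_mod.
Qed.

End Column.

Theorem elementary_generate g : K g.
Proof.
suff generated_from k : (k <= n)%N -> forall g, unit_columns (n - k) g -> K g.
  by apply: (generated_from n) => //; rewrite subnn.
elim: k => [_|k IH ltk] {}g sg.
  suff -> : g = 1%g by exact: subgroup1.
  by apply/val_inj/matrixP => a b; rewrite sg ?subn0 // !mxE.
have tn : (n - k.+1 < n)%N by rewrite -subSn // subSS leq_subr.
apply: (@column_reduce (Ordinal tn)) => // h sh.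
by apply: (IH (ltnW ltk)); rewrite -subSS subSn.
Qed.

End Gauss.

(** * Koszul rows and transvections along unimodular vectors *)

Section Koszul.
Local Open Scope ring_scope.
Variable n : nat.
Implicit Types (v : 'cV[int]_n) (w u : 'rV[int]_n) (K : set (SL n int)).

Lemma third_index (hn : (3 <= n)%N) (i j : 'I_n) : exists h, h != i /\ h != j.
Proof.
suff /subsetPn[h _] : ~~ ([set: 'I_n]%SET \subset [set i; j]%SET).
  by rewrite !inE negb_or => /andP[]; exists h.
apply: contraL hn => /subset_leq_card; rewrite cardsT card_ord cards2 -leqNgt.
by move/leq_trans; apply; case: (i != j).
Qed.

(** The basic relations [v_l v_k - v_k v_l = 0] between the entries of [v], as
    rows killing [v]. *)
Definition koszul v (k l : 'I_n) : 'rV[int]_n := v l 0 *: erow k - v k 0 *: erow l.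

(** The Koszul row at [k, l] kills separately the part of [v] supported on
    [k, l] and the rest of [v]. *)
Definition pair_part v (k l : 'I_n) : 'cV[int]_n := v k 0 *: ecol k + v l 0 *: ecol l.

Lemma koszulE v k l i :
  koszul v k l 0 i = v l 0 * (i == k)%:R - v k 0 * (i == l)%:R.
Proof. by rewrite !mxE. Qed.

Lemma pair_partE v k l i :
  pair_part v k l i 0 = v k 0 * (i == k)%:R + v l 0 * (i == l)%:R.
Proof. by rewrite !mxE !andbT. Qed.

Lemma koszul_mul v k l : koszul v k l *m v = 0.
Proof.
rewrite mulmxBl -!scalemxAl !erow_mul !scale_scalar_mx mulrC.
exact: subrr.
Qed.

Lemma koszul_pair v k l : k != l -> koszul v k l *m pair_part v k l = 0.
Proof.
move=> kl; rewrite mulmxBl -!scalemxAl !erow_mul !scale_scalar_mx !pair_partE.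
by rewrite !eqxx (negPf kl) eq_sym (negPf kl) !mulr0 !mulr1 addr0 add0r mulrC subrr.
Qed.

Lemma koszul_rest v k l : k != l -> koszul v k l *m (v - pair_part v k l) = 0.
Proof. by move=> kl; rewrite mulmxBr koszul_mul koszul_pair // subrr. Qed.

Lemma koszul_rest_disjoint v k l i : k != l ->
  (v - pair_part v k l) i 0 = 0 \/ koszul v k l 0 i = 0.
Proof.
move=> kl; rewrite koszulE mxE [X in _ + X]mxE pair_partE.
have [->|ik] := eqVneq i k.
  by left; rewrite (negPf kl) mulr1 mulr0 addr0 subrr.
have [->|il] := eqVneq i l; last by right; rewrite !mulr0 subrr.
by left; rewrite mulr1 mulr0 add0r subrr.
Qed.

(** Exactness of the Koszul complex of [v] at its first syzygies, up to the
    denominator [d]: expand [(u v) w - (w v) u]. *)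
Lemma koszul_sum v w u (d : int) : w *m v = 0 -> u *m v = d%:M ->
  d *: w = \sum_k \sum_l (w 0 k * u 0 l) *: koszul v k l.
Proof.
move=> /matrixP/(_ 0 0); rewrite !mxE => wv /matrixP/(_ 0 0).
rewrite !mxE eqxx mulr1n => uv.
have E : forall k l, (w 0 k * u 0 l) *: koszul v k l =
    (u 0 l * v l 0) *: (w 0 k *: erow k) - (w 0 k * v k 0) *: (u 0 l *: erow l).
  by move=> k l; rewrite scalerBr !scalerA; congr (_ *: _ - _ *: _); ring.
under eq_bigr => k _ do under eq_bigr => l _ do rewrite E.
under eq_bigr => k _ do rewrite sumrB -scaler_suml -scaler_sumr uv -row_sum_erow.
by rewrite sumrB -scaler_sumr -row_sum_erow -scaler_suml wv scale0r subr0.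
Qed.

Variable K : set (SL n int).
Hypothesis gK : is_subgroup K.
Variable q : int.
Hypothesis KE : forall i j : 'I_n, i != j -> K (tv (q *: ecol i) (erow j)).
Hypothesis hn : (3 <= n)%N.

(** Split [v] as [p + r], with [p] its part on [k, l].  The transvection for [r]
    has disjoint supports; the one for [p] is the commutator, through an index
    [h] outside [k, l], of two transvections with disjoint supports.  The
    commutator is what costs a second factor [q]. *)
Lemma tv_koszul_mem v (c : int) k l : k != l ->
  K (tv ((q * q * c) *: v) (koszul v k l)).
Proof.
move=> kl; set y := koszul v k l; set p := pair_part v k l.
have -> : (q * q * c) *: v = (q * q * c) *: p + (q * q * c) *: (v - p).
  by rewrite -scalerDr addrC subrK.
rewrite -tv_addl -?scalemxAr ?koszul_pair ?koszul_rest ?scaler0 //.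
apply: subgroupM => //; last first.
  rewrite -mulrA -scalerA; apply: tv_disjoint => // [i|i j ij _ _]; last exact: KE.
  by rewrite mxE; case: (koszul_rest_disjoint v i kl) => ->; [left; rewrite mulr0 | right].
have [h [hk hl]] := third_index hn k l.
have ph : p h 0 = 0 by rewrite pair_partE (negPf hk) (negPf hl) !mulr0 addr0.
have yh : y 0 h = 0 by rewrite koszulE (negPf hk) (negPf hl) !mulr0 subr0.
have -> : tv ((q * q * c) *: p) y =
    tv (q *: (c *: p)) (erow h *m (q *: ecol h) *m y).
  rewrite -scalemxAr erow_ecol eqxx -scalemxAl mul1mx -tv_scale !scalerA.
  by congr (tv (_ *: _) _); ring.
rewrite -tv_commutator.
- apply: subgroup_commutator => //.
    apply: tv_disjoint => // [i|i j ij _ _]; last exact: KE.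
    have [->|ih] := eqVneq i h; first by left; rewrite mxE ph mulr0.
    by right; rewrite mxE (negPf ih) andbF.
  apply: tv_disjoint => // [i|i j ij _ _]; last exact: KE.
  have [->|ih] := eqVneq i h; first by right.
  by left; rewrite mxE (negPf ih).
- by rewrite -!scalemxAr erow_mul ph raddf0 !scaler0.
- by rewrite -scalemxAr mul_ecol yh raddf0 scaler0.
- by rewrite -!scalemxAr koszul_pair // !scaler0.
Qed.

(** Allowing a denominator [d] in the unimodularity of [v] makes the result
    usable after a change of basis that is invertible only over the rationals. *)
Lemma tv_unimodular_mem v w u (d : int) : w *m v = 0 -> u *m v = d%:M ->
  K (tv ((q * q * d) *: v) w).
Proof.
move=> wv uv; have -> : tv ((q * q * d) *: v) w = tv ((q * q) *: v) (d *: w).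
  by rewrite -tv_scale scalerA [d * _]mulrC.
rewrite (koszul_sum wv uv).
apply: tv_sumr => // [k|k].
  rewrite mulmx_suml big1 // => l _.
  by rewrite -scalemxAl -scalemxAr koszul_mul !scaler0.
apply: tv_sumr => // [l|l].
  by rewrite -scalemxAl -scalemxAr koszul_mul !scaler0.
rewrite -tv_scale scalerA [_ * (q * q)]mulrC.
have [<-|kl] := eqVneq k l; last exact: tv_koszul_mem.
by rewrite /koszul subrr tv0r; apply: subgroup1.
Qed.

End Koszul.

(** * The normal subgroup generated by transvections of level m *)

Section Congruence.
Local Open Scope ring_scope.
Variables (n : nat) (m : int).
Implicit Types (v : 'cV[int]_n) (w u : 'rV[int]_n) (g : SL n int).

Definition unimodular_transvections : set (SL n int) :=
  [set x | exists v w u, [/\ w *m v = 0, u *m v = 1%:M & x = tv (m *: v) w]].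

Let T := generated unimodular_transvections.

Lemma transvections_normal : normal_subgroup T.
Proof.
apply: generated_normal => g x [v [w [u [wv uv ->]]]].
have ug := SL_unitmx g.
exists (g *m v), (w *m invmx g), (u *m invmx g); split.
- by rewrite mulmxA mulmxKV.
- by rewrite mulmxA mulmxKV.
by rewrite tv_conj -?scalemxAr ?wv ?scaler0.
Qed.

Let nT := transvections_normal.
Let gT := proj1 transvections_normal.

Lemma tv_unimodular_level v w u : w *m v = 0 -> u *m v = 1%:M -> T (tv (m *: v) w).
Proof. by move=> wv uv; apply: sub_generated; exists v, w, u. Qed.

Lemma elementary_level (i j : 'I_n) : i != j -> T (tv (m *: ecol i) (erow j)).
Proof.
move=> ij; apply: (@tv_unimodular_level _ _ (erow i)); rewrite erow_ecol ?eqxx //.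
by rewrite (negPf ij) raddf0.
Qed.

Lemma tv_disjoint_level v w : (forall i, v i 0 = 0 \/ w 0 i = 0) -> T (tv (m *: v) w).
Proof.
by move=> disj; apply: tv_disjoint => // i j ij _ _; apply: elementary_level.
Qed.

Lemma eqmod_mulr x t : T t -> eqmod T (x * t)%g x.
Proof.
move=> Tt; rewrite -[X in eqmod _ _ X](mulg1 x).
by apply: (eqmodM nT); [apply: (eqmod_refl nT) | apply: (eqmod1 nT)].
Qed.

Hypothesis hn : (3 <= n)%N.
Hypothesis m_neq0 : m != 0.

(** The conjugate is [tv v w] with [v = g e_i] and [w = f_j g^-1], which are
    congruent to [e_i] and [f_j] modulo [m].  Changes of [w] by multiples of [m]
    that kill [v] do not matter modulo [T], as [v] is unimodular, so [w] may be
    taken to be the Koszul row [y] of [v] at [j, i].  Then the part of [v] outside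
    [i, j], a multiple of [m] whose support is disjoint from that of [y], may be
    dropped.  What is left is a commutator through a third index [h], whose two
    entries can be replaced by the elementary matrices they are congruent to. *)
Lemma congruence_central g (Z : 'M[int]_n) (i j : 'I_n) : i != j ->
  g = 1%:M + m *: Z :> 'M_n ->
  eqmod T (g * tv (ecol i) (erow j) * g^-1)%g (tv (ecol i) (erow j)).
Proof.
move=> ij gE; have ug := SL_unitmx g.
have ji : j != i by rewrite eq_sym.
have giE : invmx g = 1%:M - m *: (Z *m invmx g).
  apply/(canRL (addrK _)); rewrite scalemxAl -[X in X + _]mul1mx -mulmxDl -gE.
  exact: mulmxV.
rewrite tv_conj; last by rewrite erow_ecol (negPf ij) raddf0.
set v := g *m ecol i; set w := erow j *m invmx g.
have wv : w *m v = 0 by rewrite /w /v mulmxA mulmxKV // erow_ecol (negPf ij) raddf0.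
have uv : (erow i *m invmx g) *m v = 1%:M by rewrite /v mulmxA mulmxKV // erow_ecol eqxx.
pose v1 := Z *m ecol i.
have vE : v = ecol i + m *: v1 by rewrite /v gE mulmxDl mul1mx -scalemxAl.
pose w1 := - (erow j *m (Z *m invmx g)).
have wE : w = erow j + m *: w1 by rewrite /w giE mulmxBr mulmx1 -scalemxAr scalerN.
clearbody v1 w1 v w.
pose y1 := koszul v1 j i; pose y := koszul v j i.
have yE : y = erow j + m *: y1.
  apply/rowP => a; rewrite /y /y1 /koszul !mxE vE !mxE !eqxx ?(negPf ij) ?(negPf ji) ?andbT /=.
  by ring.
pose p1 := pair_part v1 j i; pose p := pair_part v j i.
have pE : p = ecol i + m *: p1.
  apply/colP => a; rewrite /p /p1 /pair_part !mxE vE !mxE !eqxx ?(negPf ij) ?(negPf ji) ?andbT /=.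
  by ring.
have yv : y *m v = 0 by apply: koszul_mul.
have yp : y *m p = 0 by apply: koszul_pair.
have yr : y *m (v - p) = 0 by rewrite mulmxBr yv yp subrr.
(* Modulo T, the row w may be replaced by the Koszul row y. *)
have -> : tv v w = (tv v y * tv v (w - y))%g.
  rewrite tv_addr //; first by congr tv; rewrite addrC subrK.
  by rewrite (mulmxBl w) wv yv subrr.
have wyE : w - y = m *: (w1 - y1).
  by rewrite wE yE (scalerBr m w1 y1) opprD addrACA subrr add0r.
apply: (eqmod_trans nT (eqmod_mulr _ _)).
  rewrite wyE -tv_scale; apply: (tv_unimodular_level _ uv).
  by apply: (scalemx_inj m_neq0); rewrite scaler0 scalemxAl -wyE (mulmxBl w) wv yv subrr.
(* Modulo T, the column v may be replaced by its part p on i, j. *)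
have -> : tv v y = (tv p y * tv (v - p) y)%g by rewrite tv_addl //; congr tv; rewrite addrC subrK.
have vpE : v - p = m *: (v1 - p1).
  by rewrite vE pE (scalerBr m v1 p1) opprD addrACA subrr add0r.
apply: (eqmod_trans nT (eqmod_mulr _ _)).
  rewrite vpE; apply: tv_disjoint_level => a.
  case: (koszul_rest_disjoint v a ji) => [|->]; last by right.
  rewrite -/p vpE mxE => /eqP; rewrite mulf_eq0 (negPf m_neq0) => /eqP->; by left.
have [h [hi hj]] := third_index hn i j.
have ph : p h 0 = 0 by rewrite pair_partE (negPf hi) (negPf hj) !mulr0 addr0.
have p1h : p1 h 0 = 0 by rewrite pair_partE (negPf hi) (negPf hj) !mulr0 addr0.
have yh : y 0 h = 0 by rewrite koszulE (negPf hi) (negPf hj) !mulr0 subr0.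
have y1h : y1 0 h = 0 by rewrite koszulE (negPf hi) (negPf hj) !mulr0 subr0.
have -> : tv p y = (tv p (erow h) * tv (ecol h) y * (tv p (erow h))^-1 * (tv (ecol h) y)^-1)%g.
  rewrite tv_commutator ?erow_ecol ?eqxx ?mul1mx //.
    by rewrite erow_mul ph raddf0.
  by rewrite mul_ecol yh raddf0.
have -> : tv (ecol i) (erow j) = (tv (ecol i) (erow h) * tv (ecol h) (erow j) *
    (tv (ecol i) (erow h))^-1 * (tv (ecol h) (erow j))^-1)%g.
  rewrite tv_commutator ?erow_ecol ?eqxx ?mul1mx //.
  - by rewrite eq_sym (negPf hi) raddf0.
  - by rewrite (negPf hj) raddf0.
  - by rewrite (negPf ij) raddf0.
have Ep : eqmod T (tv p (erow h)) (tv (ecol i) (erow h)).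
  have -> : tv p (erow h) = (tv (ecol i) (erow h) * tv (m *: p1) (erow h))%g.
    rewrite tv_addl ?pE // ?erow_ecol 1?eq_sym ?(negPf hi) ?raddf0 //.
    by rewrite -scalemxAr erow_mul p1h raddf0 scaler0.
  apply: eqmod_mulr; apply: tv_disjoint_level => a.
  by have [->|ah] := eqVneq a h; [left | right; rewrite mxE (negPf ah) andbF].
have Ey : eqmod T (tv (ecol h) y) (tv (ecol h) (erow j)).
  have -> : tv (ecol h) y = (tv (ecol h) (erow j) * tv (m *: ecol h) y1)%g.
    rewrite tv_scale tv_addr ?yE // ?erow_ecol ?(negPf hj) ?raddf0 //.
    by rewrite -scalemxAl mul_ecol y1h raddf0 scaler0.
  apply: eqmod_mulr; apply: tv_disjoint_level => a.
  by have [->|ah] := eqVneq a h; [right | left; rewrite mxE (negPf ah)].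
by do !apply: (eqmodM nT) => //; apply: (eqmodV nT).
Qed.

End Congruence.

Section Cover.
Local Open Scope ring_scope.
Variables (n k : nat).
Hypothesis hn : (3 <= n)%N.
Let m : int := k.+1%:Z.
Let T := generated (@unimodular_transvections n m).
Implicit Types (g h : SL n int).

Definition reduction g : 'M['I_k.+1]_n := \matrix_(i, j) inord `|(g i j %% m)%Z|%N.

Lemma reduction_eq g h : reduction g = reduction h ->
  exists Z, (g^-1 * h)%g = 1%:M + m *: Z :> 'M_n.
Proof.
move=> /matrixP rgh; pose Z : 'M_n := \matrix_(i, j) ((h i j - g i j) %/ m)%Z.
have hE : SLval h = SLval g + m *: Z.
  apply/matrixP => i j; have := rgh i j; rewrite !mxE => /(congr1 val) /=.
  rewrite !inordK; try by rewrite -ltz_nat gez0_abs ?modz_ge0 ?ltz_pmod.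
  move/(congr1 Posz); rewrite !gez0_abs ?modz_ge0 // => E.
  rewrite mulrC divzK; first by rewrite addrC subrK.
  by rewrite -eqz_mod_dvd; apply/eqP.
exists (invmx g *m Z); rewrite [SLval _]/= hE mulmxDr mulVmx ?SL_unitmx //.
by rewrite -scalemxAr.
Qed.

Let rep (c : 'M['I_k.+1]_n) : SL n int := xget 1%g [set g | reduction g = c].

Lemma reduction_rep g : reduction (rep (reduction g)) = reduction g.
Proof. exact: (@xgetI _ 1%g [set h | reduction h = reduction g] g). Qed.

(** By centrality modulo [T] of the matrices congruent to 1 modulo [m], the
    conjugates of elementary matrices by one representative of each residue
    class exhaust all their conjugates modulo [T]. *)
Definition representative_conjugates : seq (SL n int) :=
  [seq rep c * tv (ecol ij.1) (erow ij.2) * (rep c)^-1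
    | c <- enum {: 'M['I_k.+1]_n},
      ij <- enum [pred ij : 'I_n * 'I_n | ij.1 != ij.2]]%g.

Lemma conjugate_representative g (i j : 'I_n) : i != j ->
  exists2 x, x \in representative_conjugates &
    eqmod T (g * tv (ecol i) (erow j) * g^-1)%g x.
Proof.
move=> ij; pose r := rep (reduction g).
exists (r * tv (ecol i) (erow j) * r^-1)%g.
  apply/allpairsP; exists (reduction g, (i, j)); split=> //=; last first.
    by rewrite mem_enum inE.
  by rewrite mem_enum.
have [Z EZ] := reduction_eq (reduction_rep g); rewrite -/r in EZ.
have nT := transvections_normal n m.
have := congruence_central hn (isT : m != 0) ij EZ.
set e := tv _ _ => central.
have -> : (g * e * g^-1 = r * ((r^-1 * g) * e * (r^-1 * g)^-1) * r^-1)%g.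
  by rewrite invgM invgK !mulgA mulgV mul1g mulgK.
by do 2?[apply: (eqmodM nT)] => //; apply: (eqmod_refl nT).
Qed.

Theorem transvections_cover :
  exists S : seq (SL n int), forall g, exists2 s, s \in S & T (s^-1 * g)%g.
Proof.
have nT := transvections_normal n m; have gT := proj1 nT.
apply: (@dietzmann _ _ nT representative_conjugates k.+1) => // [g x|x|H gH TH XH].
- case/allpairsP=> -[c [i j]] /= [_]; rewrite mem_enum inE /= => ij ->.
  have [x' x'X eqx] := conjugate_representative (g * rep c)%g ij.
  by exists x' => //; move: eqx; rewrite invgM !mulgA.
- case/allpairsP=> -[c [i j]] /= [_]; rewrite mem_enum inE /= => ij ->.
  have -> : (rep c * tv (ecol i) (erow j) * (rep c)^-1 =
      tv (ecol i) (erow j) ^ (rep c)^-1)%g by rewrite conjgE invgK mulgA.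
  rewrite -conjXg conjgE invgK mulgA; apply: (proj2 nT).
  rewrite tv_exp ?erow_ecol ?(negPf ij) ?raddf0 // natz -tv_scale.
  exact: elementary_level.
apply: elementary_generate => // i j ij.
have [x xX] := conjugate_representative 1%g ij.
rewrite /eqmod mul1g invg1 mulg1 => /TH Hex.
rewrite -[tv _ _]invgK; apply: subgroupV => //.
by rewrite -[_^-1%g](mulgK x); apply: subgroupM => //; apply: subgroupV => //; apply: XH.
Qed.

End Cover.

(** * Two elements generating transvections of some level *)

Section TwoGenerators.
Local Open Scope ring_scope.
Variable n : nat.
Local Notation N := n.+1.
Implicit Types (v : 'cV[int]_N) (w u : 'rV[int]_N) (g h : SL N int).

(** The standard row of index [i - 1], and 0 when [i = 0]. *)
Definition prev_row (i : 'I_N) : 'rV[int]_N := \row_j (i == j.+1 :> nat)%:R.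

Lemma prev_row0 : prev_row ord0 = 0.
Proof. by apply/rowP => j; rewrite !mxE. Qed.

Lemma prev_rowS (i j : 'I_N) : i = j.+1 :> nat -> prev_row i = erow j.
Proof. by move=> ij; apply/rowP => k; rewrite !mxE ij eqSS eq_sym -val_eqE. Qed.

Definition subdiagonal (q : int) (g : SL N int) :=
  forall i : 'I_N, erow i *m g = erow i + q *: prev_row i.

(** The matrix is the product of the elementary matrices [tv (q e_(j+1)) f_j] in
    the order of increasing [j], the order in which no cross terms appear. *)
Lemma subdiagonal_mem (K : set (SL N int)) (q : int) : is_subgroup K ->
  (forall i j : 'I_N, i = j.+1 :> nat -> K (tv (q *: ecol i) (erow j))) ->
  exists2 b, K b & subdiagonal q b.
Proof.
move=> gK KE; suff E k : (k < N)%N -> exists2 b : SL N int, K b &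
    forall i : 'I_N, erow i *m b = erow i + (q * (i <= k)%N%:R) *: prev_row i.
  have [b Kb bE] := E n (ltnSn n); exists b => // i.
  by rewrite bE -ltnS ltn_ord mulr1.
elim: k => [_|k IH ltk].
  exists 1%g; first exact: subgroup1.
  move=> i; rewrite [SLval _]/= mulmx1 leqn0.
  have [i0|_] := eqVneq (i : nat) 0%N; last by rewrite mulr0 scale0r addr0.
  have -> : i = ord0 by apply/val_inj.
  by rewrite prev_row0 scaler0 addr0.
have [b Kb bE] := IH (ltnW ltk).
pose s : 'I_N := Ordinal ltk; pose r : 'I_N := Ordinal (ltnW ltk).
have rs : erow r *m ecol s = 0.
  by rewrite erow_ecol -val_eqE /= gtn_eqF ?raddf0.
exists (b * tv (q *: ecol s) (erow r))%g.
  by apply: subgroupM => //; apply: KE.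
move=> i; rewrite [SLval _]/= mulmxA bE val_tv; last by rewrite -scalemxAr rs scaler0.
rewrite mulmxDr mulmx1 -!scalemxAl -scalemxAr mulmxA mulmxDl erow_ecol.
have -> : (q * (i <= k)%:R) *: prev_row i *m ecol s = 0.
  rewrite -scalemxAl mul_ecol mxE; have [lik|_] := leqP i k; last by rewrite mulr0 scale0r.
  by rewrite ltn_eqF ?raddf0 ?scaler0 // ltnS ltnW // ltnS.
rewrite addr0 mul_scalar_mx -addrA; congr (_ + _).
have [<-|si] := eqVneq s i.
  by rewrite ltnn leqnn mulr0 scale0r add0r mulr1 scale1r (@prev_rowS s r).
rewrite scale0r scaler0 addr0 [in RHS]leq_eqVlt ltnS.
by rewrite -val_eqE /= eq_sym in si; rewrite (negPf si).
Qed.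

Variables (q : int) (b : SL N int).
Hypothesis q_neq0 : q != 0.
Hypothesis bE : subdiagonal q b.

Lemma subdiagonal_mul0 v : (b *m v) ord0 0 = v ord0 0.
Proof.
have := congr1 (fun x => (x *m v) 0 0) (bE ord0).
by rewrite prev_row0 scaler0 addr0 -mulmxA !erow_mul !mxE.
Qed.

Lemma subdiagonal_mulS v (i j : 'I_N) : i = j.+1 :> nat ->
  (b *m v) i 0 = v i 0 + q * v j 0.
Proof.
move=> ij; have := congr1 (fun x => (x *m v) 0 0) (bE i).
rewrite (prev_rowS ij) -mulmxA mulmxDl -scalemxAl !erow_mul.
by rewrite [RHS]mxE [X in _ = _ + X]mxE ![(_%:M) _ _]mxE eqxx !mulr1n.
Qed.

Lemma ordinal_pred (i : 'I_N) k : i = k.+1 :> nat -> exists j : 'I_N, i = j.+1 :> nat /\ j = k :> nat.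
Proof.
move=> ik; have ltk : (k < N)%N by apply: ltnW; rewrite -ik.
by exists (Ordinal ltk).
Qed.

(** The entries of [y = b^-1 e_0] satisfy [y_0 = 1] and [y_(i+1) = - q y_i]. *)
Lemma inv_ecol_neq0 (i : 'I_N) : (invmx b *m ecol ord0) i 0 != 0.
Proof.
set y := _ *m _; have by_ : b *m y = ecol ord0 by rewrite mulmxA mulmxV ?SL_unitmx ?mul1mx.
have [k] := ubnP (i : nat); elim: k i => // k IH i.
case Ei : (i : nat) => [|l].
  have -> : i = ord0 by apply: val_inj.
  by have := subdiagonal_mul0 y; rewrite by_ mxE => <-.
move=> ltk; have [j [ij jl]] := ordinal_pred Ei.
have := subdiagonal_mulS y ij; rewrite by_ mxE -val_eqE /= Ei => /eqP.
rewrite eq_sym addr_eq0 => /eqP->; rewrite oppr_eq0 mulf_neq0 // IH // jl.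
by rewrite -ltnS.
Qed.

Lemma orbit_gt k (i : 'I_N) : (k < i)%N -> ((b ^+ k)%g *m ecol ord0) i 0 = 0.
Proof.
elim: k i => [|k IH] i lti.
  by rewrite [SLval _]/= mul1mx mxE -val_eqE /= gtn_eqF.
case Ei : (i : nat) lti => [|l] // lti; have [j [ij jl]] := ordinal_pred Ei.
rewrite expgS [SLval _]/= -mulmxA (subdiagonal_mulS _ ij) !IH ?mulr0 ?addr0 //.
  by rewrite jl -ltnS.
by rewrite Ei ltnW.
Qed.

Lemma orbit_diag k (i : 'I_N) : i = k :> nat -> ((b ^+ k)%g *m ecol ord0) i 0 = q ^+ k.
Proof.
elim: k i => [|k IH] i Ei.
  have -> : i = ord0 by apply: val_inj.
  by rewrite [SLval _]/= mul1mx mxE.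
have [j [ij jl]] := ordinal_pred Ei.
by rewrite expgS [SLval _]/= -mulmxA (subdiagonal_mulS _ ij) orbit_gt ?Ei // IH // add0r exprS.
Qed.

(** The columns [b ^ k e_0]; the matrix is upper triangular, with the powers of
    [q] on the diagonal. *)
Definition orbit_mx : 'M[int]_N := \matrix_(i, k) ((b ^+ k)%g *m ecol ord0) i 0.

Lemma orbit_mx_ecol (k : 'I_N) : orbit_mx *m ecol k = (b ^+ k)%g *m ecol ord0.
Proof. by rewrite -colE; apply/colP => i; rewrite !mxE. Qed.

Lemma det_orbit_mx : \det orbit_mx != 0.
Proof.
rewrite -det_tr det_trig; last by apply/is_trig_mxP => i j ij; rewrite mxE mxE orbit_gt.
by apply/prodf_neq0 => i _; rewrite mxE mxE orbit_diag // expf_neq0.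
Qed.

Variable H : set (SL N int).
Hypothesis gH : is_subgroup H.
Hypothesis Hb : H b.
Hypothesis Ha : H (tv (q *: ecol ord0) (erow ord_max)).
Hypothesis hn : (3 <= N)%N.

(** Descending induction on [j].  With [y = b^-1 e_0], the conjugate of
    [tv (M e_0) f_j] by [b^-1] is [tv (M y) (f_j + q f_(j-1))].  Its row kills
    [e_0] as long as [j > 1], and [f_j y] is nonzero, so the commutator of the two
    is a nontrivial multiple of [e_0 (f_j + q f_(j-1))]. *)
Lemma first_row_mem (j : 'I_N) : (0 < j)%N ->
  exists2 M : int, M != 0 & H (tv (M *: ecol ord0) (erow j)).
Proof.
have [k] := ubnP (N - j); elim: k j => // k IH i; rewrite ltnS => le_k i_gt0.
have [->|] := eqVneq i ord_max; first by exists q.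
rewrite -val_eqE /= => i_max.
have ltin : (i.+1 < N)%N by rewrite ltnS ltn_neqAle i_max -ltnS ltn_ord.
pose j : 'I_N := Ordinal ltin; have ji : j = i.+1 :> nat by [].
have [M M0 HM] : exists2 M : int, M != 0 & H (tv (M *: ecol ord0) (erow j)).
  by apply: IH => //; apply: leq_trans le_k; rewrite /= subnS prednK // subn_gt0.
have j0 : erow j *m ecol ord0 = 0 by rewrite erow_ecol raddf0.
have i0 : erow i *m ecol ord0 = 0.
  by rewrite erow_ecol -val_eqE /= ltn_eqF // raddf0.
pose y := invmx b *m ecol ord0; pose c := M * (M * y j 0).
have c0 : c != 0 by rewrite !mulf_neq0 // inv_ecol_neq0.
have jM : erow j *m (M *: ecol ord0) = 0 by rewrite -scalemxAr j0 scaler0.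
have w0 : (erow j *m b) *m ecol ord0 = 0.
  by rewrite bE (prev_rowS ji) mulmxDl -scalemxAl j0 i0 scaler0 addr0.
have Hconj : H (tv (M *: y) (erow j *m b)).
  have -> : tv (M *: y) (erow j *m b) =
      (b^-1 * tv (M *: ecol ord0) (erow j) * b^-1^-1)%g.
    by rewrite tv_conj // [SLval _]/= invmxK scalemxAr.
  by apply: subgroupM => //; [apply: subgroupM => // |]; do ?apply: subgroupV => //.
have Hcomm : H (tv (c *: ecol ord0) (erow j *m b)).
  have := subgroup_commutator gH HM Hconj.
  rewrite tv_commutator //.
  - by rewrite -scalemxAr erow_mul scale_scalar_mx mul_scalar_mx -tv_scale scalerA mulrC.
  - by rewrite -scalemxAr /y mulmxA mulmxK ?SL_unitmx ?j0 ?scaler0.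
  - by rewrite -scalemxAr w0 scaler0.
exists (c * q); first by rewrite mulf_neq0.
have -> : tv ((c * q) *: ecol ord0) (erow i) =
    (tv (c *: ecol ord0) (erow j *m b) * tv (c *: ecol ord0) (- erow j))%g.
  rewrite tv_addr -?scalemxAr ?w0 ?mulNmx ?j0 ?oppr0 ?scaler0 //.
  by rewrite bE (prev_rowS ji) addrAC subrr add0r -tv_scale scalerA [q * c]mulrC.
apply: subgroupM => //; rewrite -tv_inv -?scalemxAr ?j0 ?scaler0 //.
apply: subgroupV => //; rewrite /c mulrC -scalerA tv_scale; exact: tv_intr.
Qed.

Lemma first_row_uniform :
  exists2 M : int, M != 0 & forall w, w *m ecol ord0 = 0 -> H (tv (M *: ecol ord0) w).
Proof.
have /choice[f fE] (j : 'I_N) : exists M : int, M != 0 /\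
    ((0 < j)%N -> H (tv (M *: ecol ord0) (erow j))).
  have [j0|/first_row_mem[M M0 HM]] := posnP j; last by exists M.
  by exists 1.
exists (\prod_j f j); first by apply/prodf_neq0 => j _; case: (fE j).
move=> w; rewrite mul_ecol => /matrixP/(_ 0 0); rewrite !mxE /= mulr1n => w0.
apply: tv_disjoint => // [i|i j ij].
  have [->|i0] := eqVneq i ord0; first by right.
  by left; rewrite mxE (negPf i0).
have [<-|j0] := eqVneq ord0 j; first by rewrite w0 eqxx.
have [i0|i0] := eqVneq i ord0; last by rewrite mxE (negPf i0).
move=> _ _; rewrite i0 (bigD1 j) //= mulrC -scalerA tv_scale.
apply: tv_intr => //; first by rewrite -scalemxAr erow_ecol (negPf j0) raddf0 scaler0.
by apply: (proj2 (fE j)); rewrite lt0n -val_eqE eq_sym in j0 *.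
Qed.

(** Conjugation of [first_row_uniform] by [b ^ k], which lies in [H]. *)
Lemma orbit_mem : exists2 M : int, M != 0 & forall k w,
  w *m ((b ^+ k)%g *m ecol ord0) = 0 -> H (tv (M *: ((b ^+ k)%g *m ecol ord0)) w).
Proof.
have [M M0 HM] := first_row_uniform; exists M => // k w w0.
set g := (b ^+ k)%g in w0 *; have Hg : H g by apply: subgroupX.
have -> : tv (M *: (g *m ecol ord0)) w =
    (g * tv (M *: ecol ord0) (w *m g) * g^-1)%g.
  by rewrite tv_conj -?scalemxAr -?mulmxA ?w0 ?scaler0 // mulmxV ?SL_unitmx ?mulmx1.
apply: subgroupM => //; last exact: subgroupV.
by apply: subgroupM => //; apply: HM; rewrite -mulmxA.
Qed.

(** Let [K] be the group of integral matrices in [P^-1 H P], where [P] is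
    [orbit_mx] and [d] its determinant.  By [orbit_mem], [K] contains powers of
    all elementary matrices, hence transvections along every vector that is
    unimodular up to the factor [d]; for [R] the adjugate of [P], the vectors
    [R v] with [v] unimodular are such, and transporting back by [P] gives [H]. *)
Theorem two_generators_transvections :
  exists k : nat, unimodular_transvections k.+1%:Z `<=` H.
Proof.
have [M M0 HM] := orbit_mem.
pose P := orbit_mx; pose R := \adj P; pose d := \det P.
have d0 : d != 0 := det_orbit_mx.
have RP : R *m P = d%:M := mul_adj_mx P.
have PR : P *m R = d%:M := mul_mx_adj P.
(* Membership of P x P^-1 in H, stated without inverting P. *)
pose K := [set x : SL N int | exists2 h, H h & h *m P = P *m x].
have gK : is_subgroup K.
  apply/is_subgroupP; split.
  - by exists 1%g; [apply: subgroup1 | rewrite /= mulmx1 mul1mx].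
  - move=> x y [h Hh hP] [h' Hh' h'P]; exists (h * h')%g; first exact: subgroupM.
    by rewrite [SLval _]/= -mulmxA h'P mulmxA hP -mulmxA.
  - move=> x [h Hh hP]; exists h^-1%g; first exact: subgroupV.
    rewrite /=; apply: (canRL (mulmxK (SL_unitmx x))).
    by rewrite -mulmxA -hP mulmxA mulVmx ?SL_unitmx ?mul1mx.
pose Q := d * M.
have KE (i j : 'I_N) : i != j -> K (tv (Q *: ecol i) (erow j)).
  move=> ij; pose v := P *m ecol i; pose r := erow j *m R.
  have rv : r *m v = 0.
    by rewrite /r /v -mulmxA (mulmxA R) RP mul_scalar_mx -scalemxAr erow_ecol (negPf ij) raddf0 scaler0.
  exists (tv (M *: v) r).
    by rewrite /v orbit_mx_ecol; apply: HM; rewrite -orbit_mx_ecol.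
  rewrite !val_tv -?scalemxAr ?rv ?erow_ecol ?(negPf ij) ?raddf0 ?scaler0 //.
  rewrite mulmxDl mulmxDr mul1mx mulmx1; congr (_ + _).
  rewrite -mulmxA -[r *m P]mulmxA RP mul_mx_scalar -!scalemxAl -!scalemxAr scalerA.
  by rewrite /v mulmxA [M * d]mulrC.
have m_gt0 : 0 < (Q * d) * (Q * d) by rewrite -expr2 exprn_even_gt0 // !mulf_neq0 ?orbT.
exists `|(Q * d) * (Q * d)|.-1; rewrite prednK ?absz_gt0 ?gt_eqF // gez0_abs ?ltW //.
move=> _ [v [w [u [wv uv ->]]]].
have [|| h Hh hP] := @tv_unimodular_mem _ _ gK Q KE hn (R *m v) (w *m P) (u *m P) d.
- by rewrite -mulmxA (mulmxA P) PR mul_scalar_mx -scalemxAr wv scaler0.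
- by rewrite -mulmxA (mulmxA P) PR mul_scalar_mx -scalemxAr uv scalemx1.
suff <- : h = tv (Q * d * (Q * d) *: v) w by [].
apply/val_inj; apply: (scalemx_inj d0) => /=.
rewrite -[d *: SLval h]mul_mx_scalar -[d *: SLval (tv _ _)]mul_mx_scalar -PR !mulmxA hP.
congr (_ *m R).
rewrite !val_tv -?scalemxAr ?wv ?scaler0 //; last first.
  by rewrite -mulmxA (mulmxA P) PR mul_scalar_mx -scalemxAr wv !scaler0.
rewrite mulmxDl mulmxDr mul1mx mulmx1; congr (_ + _).
rewrite -!scalemxAl -!scalemxAr !mulmxA PR mul_scalar_mx -!scalemxAl scalerA.
by congr (_ *: _); ring.
Qed.

End TwoGenerators.

Theorem mainTheorem2 (n : nat) (hn : (3 <= n)%N) (Gamma : set (SL n int))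
    (Gamma_subgroup : is_subgroup Gamma)
    (Gamma_finite_index : finite_index Gamma setT) :
  exists a b : SL n int,
    [/\ Gamma a, Gamma b & finite_index (generated [set a; b]) Gamma].
Proof.
case: n hn Gamma Gamma_subgroup Gamma_finite_index => // n hn Gamma gG fG.
have [q q_gt0 Gq] := finite_index_exponent gG fG.
have GE (i j : 'I_n.+1) : i != j -> Gamma (tv (q%:Z *: ecol i) (erow j)).
  move=> ij; rewrite tv_scale -natz -tv_exp; first exact: Gq.
  by rewrite erow_ecol (negPf ij) raddf0.
have [|b Gb bE] := subdiagonal_mem gG (q := q%:Z).
  by move=> i j ij; apply: GE; rewrite -val_eqE /= ij gtn_eqF.
pose a := tv (q%:Z *: ecol (ord0 : 'I_n.+1)) (erow ord_max).
have Ga : Gamma a by apply: GE; rewrite -val_eqE /= ltn_eqF // -ltnS ltnW.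
have gH := generated_subgroup [set a; b].
have q0 : (q%:Z != 0)%R by rewrite eqz_nat -lt0n.
have [||k TH] := two_generators_transvections q0 bE gH _ _ hn.
- by apply: sub_generated; right.
- by apply: sub_generated; left.
exists a, b; split=> //.
have [S cover] := transvections_cover k hn.
apply: (finite_index_of_cover gH _ _ cover); first exact: generated_sub.
by apply: generated_sub => // x [->|->].
Qed.
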